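(* Let $0<q<1$, $0<\alpha\le 1$, $n_0\in\mathbb{Z}$ and $a=q^{n_0}$. Let $y:T_q\to\mathbb{R}$ be a function satisfying $y(q^{n_0})\ge 0$. Suppose that $y$ is an increasing function on $T_q$. Then $$({}_{q}\nabla_{aq}^{\alpha} y)(t)\ge 0\quad\text{for each } t=q^n \text{ with } n\in\mathbb{Z},\ n<n_0.$$
   Context: Let $0<q<1$ and $T_q=\{q^n:n\in\mathbb{Z}\}\cup\{0\}$. ''Increasing'' means: $s\le t$ in $T_q$ implies $y(s)\le y(t)$. Nabla $q$-derivative: $\nabla_q f(t)=\frac{f(t)-f(qt)}{(1-q)t}$ for $t\in T_q\setminus\{0\}$. Nabla $q$-integral: for $c=q^{m}$ and $t=q^n$ with $n\le m$, $\int_c^t f(s)\nabla_q s=(1-q)\sum_{i=n}^{m-1}q^i f(q^i)$ (equal to $0$ if $n=m$). $q$-factorial function: for $\beta\in\mathbb{R}$ not a positive integer, $(t-s)_q^{\beta}=t^{\beta}\prod_{i=0}^{\infty}\frac{1-\frac{s}{t}q^{i}}{1-\frac{s}{t}q^{i+\beta}}$. $q$-Gamma function: $\Gamma_q(x)=(1-q)^{1-x}\prod_{i=0}^\infty\frac{1-q^{i+1}}{1-q^{i+x}}$ for $x>0$. $q$-fractional integral of order $\beta>0$ starting at $c\in T_q$, $c>0$: $({}_q\nabla_c^{-\beta}f)(t)=\frac{1}{\Gamma_q(\beta)}\int_c^t (t-qs)_q^{\beta-1}f(s)\nabla_q s$. (Riemann) $q$-fractional derivative of order $\alpha\in(0,1)$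 starting at $c$: $({}_q\nabla_c^{\alpha}f)(t)=\nabla_q\big[({}_q\nabla_c^{-(1-\alpha)}f)(t)\big]$. Thus, with $c=aq=q^{n_0+1}$, $({}_q\nabla_{aq}^{\alpha}y)(t)=\nabla_q\left[\frac{1}{\Gamma_q(1-\alpha)}\int_{aq}^t(t-qs)_q^{-\alpha}y(s)\nabla_q s\right]$. For $\alpha=1$, ${}_q\nabla_c^{1}f=\nabla_q f$. *)

(* Defs.v *)
From HB Require Import structures.
From mathcomp Require Import all_boot all_order all_algebra.
From mathcomp Require Import all_classical all_reals all_analysis.
Set Implicit Arguments.
Unset Strict Implicit.
Unset Printing Implicit Defensive.
Import Order.TTheory GRing.Theory Num.Theory.
Import numFieldNormedType.Exports.
Local Open Scope classical_set_scope.
Local Open Scope ring_scope.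

(* A function on the time scale [Tq q] is represented by a function [R -> R] of
   which only the values on [Tq q] are ever constrained or used. *)
Definition Tq (R : realType) (q : R) : set R :=
  [set t | t = 0 \/ exists n : int, t = q ^ n].

Definition qincreasing (R : realType) (q : R) (y : R -> R) : Prop :=
  forall s t, Tq q s -> Tq q t -> s <= t -> y s <= y t.

Definition nablaq (R : realType) (q : R) (f : R -> R) (t : R) : R :=
  (f t - f (q * t)) / ((1 - q) * t).

(* The exponent [n] with [t = q ^ n], unique when [0 < q < 1]; it is a junk value
   when [t] is not an integer power of [q]. *)
Definition qexponent (R : realType) (q t : R) : int :=
  xget 0 [set n : int | t = q ^ n].

(* For [c = q ^ m] and [t = q ^ n] with [n <= m], the index [n + k] runs through
   the integers n, ..., m - 1.  Other bounds give a meaningless value. *)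
Definition nablaq_int (R : realType) (q c t : R) (f : R -> R) : R :=
  let m := qexponent q c in
  let n := qexponent q t in
  (1 - q) * \sum_(0 <= k < `|m - n|%N) q ^ (n + k%:Z) * f (q ^ (n + k%:Z)).

Definition infprod (R : realType) (u : nat -> R) : R :=
  limn (fun N => \prod_(0 <= i < N) u i).

(* (t - s)_q^beta *)
Definition qfactorial (R : realType) (q t s beta : R) : R :=
  t `^ beta *
  infprod (fun i => (1 - s / t * q ^+ i) / (1 - s / t * q `^ (i%:R + beta))).

Definition qGamma (R : realType) (q x : R) : R :=
  (1 - q) `^ (1 - x) *
  infprod (fun i => (1 - q ^+ i.+1) / (1 - q `^ (i%:R + x))).

Definition qfrac_int (R : realType) (q c beta : R) (f : R -> R) (t : R) : R :=
  (qGamma q beta)^-1 *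
  nablaq_int q c t (fun s => qfactorial q t (q * s) (beta - 1) * f s).

Definition qfrac_deriv (R : realType) (q c alpha : R) (f : R -> R) : R -> R :=
  if alpha == 1 then nablaq q f
  else nablaq q (qfrac_int q c (1 - alpha) f).

(* Main.v *)
(* Put [b = 1 - alpha] and [Y_k = y (q ^ (n + k))].  The kernel is homogeneous:
   [(q t - q s)_q^(b-1) = q^(b-1) (t - s)_q^(b-1)].  So the fractional integral
   at [q ^ n] is [\sum_(k <= K) w_k Y_k] with [w_k >= 0], while at [q ^ (n + 1)]
   it is [q^b \sum_(k < K) w_k Y_(k+1)].  Since [Y] is nonnegative and
   decreasing in [k] and [q^b <= 1], the second sum is termwise at most the
   first. *)
Require Import Defs.
From HB Require Import structures.
From mathcomp Require Import all_boot all_order all_algebra.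
From mathcomp Require Import all_classical all_reals all_analysis.
From mathcomp Require Import ring zify.
Set Implicit Arguments.
Unset Strict Implicit.
Unset Printing Implicit Defensive.
Import Order.TTheory GRing.Theory Num.Theory.
Import numFieldNormedType.Exports.
Local Open Scope classical_set_scope.
Local Open Scope ring_scope.

Lemma infprod_ge0 (R : realType) (u : nat -> R) :
  (forall i, 0 <= u i) -> 0 <= infprod u.
Proof.
move=> u_ge0; rewrite /infprod.
have [cv|dv] := pselect (cvgn (fun N => \prod_(0 <= i < N) u i)).
  by apply: limr_ge => //; apply: nearW => N; apply: prodr_ge0.
(* The limit of a divergent sequence is the default point of [R], namely [0]. *)
by rewrite (dvgP dv).
Qed.

(** Every factor is a quotient of nonnegative numbers. At [x = 0] the first denominator vanishes,
    and division by zero makes that factor [0]. *)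
Lemma qGamma_ge0 (R : realType) (q x : R) :
  0 < q < 1 -> 0 <= x -> 0 <= qGamma q x.
Proof.
move=> /andP[q_gt0 q_lt1] x_ge0; rewrite mulr_ge0 ?powR_ge0//.
apply: infprod_ge0 => i; rewrite divr_ge0// subr_ge0.
  by rewrite exprn_ile1 ?ltW.
rewrite -[leRHS](powRr0 q) ger_powR ?q_gt0 ?(ltW q_lt1)//.
by rewrite addr_ge0.
Qed.

(** The bounds on [s] and [b] match: [s / t] is at most [q] and the power of [q] in each denominator
    is at most [q^-1], so their product never exceeds [1]. *)
Lemma qfactorial_ge0 (R : realType) (q t s b : R) :
  0 < q < 1 -> 0 < t -> 0 <= s <= q * t -> -1 <= b -> 0 <= qfactorial q t s b.
Proof.
move=> /andP[q_gt0 q_lt1] t_gt0 /andP[s_ge0 sqt] b_ge.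
have q01 : 0 < q <= 1 by rewrite q_gt0 ltW.
have st_ge0 : 0 <= s / t by rewrite divr_ge0// ltW.
have stq : s / t <= q by rewrite ler_pdivrMr.
rewrite mulr_ge0 ?powR_ge0//; apply: infprod_ge0 => i.
rewrite divr_ge0// subr_ge0.
  by rewrite mulr_ile1 ?exprn_ge0 ?exprn_ile1 ?(le_trans stq)
             ?(ltW q_gt0) ?(ltW q_lt1).
have qib : q `^ (i%:R + b) <= q^-1.
  rewrite -powR_inv1 ?(ltW q_gt0)// ger_powR//.
  by rewrite (le_trans b_ge)// lerDr.
apply: le_trans (ler_pM st_ge0 (powR_ge0 _ _) stq qib) _.
by rewrite divff ?gt_eqF.
Qed.

(** The infinite product depends only on the ratio [s / t], so scaling affects the prefactor
    alone. *)
Lemma qfactorialZ (R : realType) (q c t s b : R) : 0 < c -> 0 <= t ->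
  qfactorial q (c * t) (c * s) b = c `^ b * qfactorial q t s b.
Proof.
move=> c_gt0 t_ge0; rewrite /qfactorial powRM ?(ltW c_gt0)// -mulrA.
by rewrite -mulf_div divff ?gt_eqF// mul1r.
Qed.

Lemma qexponentE (R : realType) (q : R) (n : int) :
  0 < q < 1 -> qexponent q (q ^ n) = n.
Proof.
move=> /andP[q_gt0 q_lt1]; apply: xget_unique => //= m.
by move/(ieexprIz q_gt0 (negbT (lt_eqF q_lt1))).
Qed.

Lemma nablaq_intE (R : realType) (q : R) (f : R -> R) (n : int) (K : nat) :
  0 < q < 1 ->
  nablaq_int q (q ^ (n + K%:Z)) (q ^ n) f =
  (1 - q) * \sum_(0 <= k < K) q ^ (n + k%:Z) * f (q ^ (n + k%:Z)).
Proof. by move=> q01; rewrite /nablaq_int !qexponentE// addrAC subrr add0r. Qed.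

Lemma qincreasing_expz (R : realType) (q : R) (y : R -> R) (i j : int) :
  0 < q < 1 -> qincreasing q y -> i <= j -> y (q ^ j) <= y (q ^ i).
Proof.
move=> /andP[q_gt0 q_lt1] y_incr ij.
apply: y_incr; [by right; exists j | by right; exists i |].
by rewrite -!powR_intmul ?(ltW q_gt0)// ger_powR ?q_gt0 ?(ltW q_lt1) ?ler_int.
Qed.

(** Used with [b = 1 - alpha] and [a = q ^ (n + K)]: the lower limit is then [a * q], and [a] is the
    smallest node of the sum at [q ^ n]. *)
Lemma le_qfrac_int (R : realType) (q b : R) (y : R -> R) (n : int) (K : nat) :
  0 < q < 1 -> 0 <= b -> qincreasing q y -> 0 <= y (q ^ (n + K%:Z)) ->
  qfrac_int q (q ^ (n + K.+1%:Z)) b y (q * q ^ n) <=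
  qfrac_int q (q ^ (n + K.+1%:Z)) b y (q ^ n).
Proof.
move=> q01 b_ge0 y_incr yK_ge0.
have /andP[q_gt0 q_lt1] := q01.
have qX_gt0 (m : int) : 0 < q ^ m by rewrite exprz_gt0.
have qXS (m : int) : q * q ^ m = q ^ (m + 1).
  by rewrite expfzDr ?gt_eqF// expr1z mulrC.
have qXDn (k : nat) : q ^ (n + k%:Z) <= q ^ n.
  rewrite expfzDr ?gt_eqF// ger_pMr//.
  by rewrite -exprnP exprn_ile1// ltW.
have y_ge0 (k : nat) : (k <= K)%N -> 0 <= y (q ^ (n + k%:Z)).
  move=> kK; apply: le_trans yK_ge0 _.
  by apply: qincreasing_expz => //; lia.
have ker_ge0 (k : nat) :
    0 <= q ^ (n + k%:Z) * qfactorial q (q ^ n) (q * q ^ (n + k%:Z)) (b - 1).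
  rewrite mulr_ge0 ?(ltW (qX_gt0 _))// qfactorial_ge0// ?lerDr//.
  by rewrite ler_pM2l// qXDn andbT mulr_ge0 ?(ltW q_gt0) ?(ltW (qX_gt0 _)).
(* Here [q] comes from the shifted integration weight and the power from the homogeneity of the
   kernel. *)
have qb_le1 : q * q `^ (b - 1) <= 1.
  have := @ger_powR _ q _ (-1) (b - 1).
  rewrite q_gt0 (ltW q_lt1) lerDr b_ge0 powR_inv1 ?(ltW q_gt0)//.
  by move=> /(_ isT isT); rewrite -ler_pdivlMl// mulr1.
rewrite ler_wpM2l ?invr_ge0 ?qGamma_ge0//.
rewrite nablaq_intE// qXS.
have -> : n + K.+1%:Z = n + 1 + K%:Z by lia.
rewrite nablaq_intE// ler_wpM2l ?subr_ge0 ?(ltW q_lt1)//.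
(* The sum at [q ^ n] has one extra term, [k = K], which is nonnegative. *)
rewrite big_nat_recr//= -[leLHS]addr0 lerD//; last first.
  by rewrite mulrA mulr_ge0 ?y_ge0.
rewrite !big_mkord; apply: ler_sum => k _.
have -> : n + 1 + k%:Z = n + k%:Z + 1 by lia.
rewrite -!qXS qfactorialZ ?(ltW (qX_gt0 _))//.
set w := q ^ _; set g := qfactorial _ _ _ _.
have wg : 0 <= w * g := ker_ge0 k.
(* Since [k < K], the shifted node [q * w] has index at most [K], where [y] is still nonnegative. *)
have /andP[yqw_ge0 yqw_le] : 0 <= y (q * w) <= y w.
  have -> : q * w = q ^ (n + k.+1%:Z) by rewrite qXS; congr (q ^ _); lia.
  by rewrite y_ge0 ?ltn_ord// qincreasing_expz//; lia.
have -> : q * w * (q `^ (b - 1) * g * y (q * w)) =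
          q * q `^ (b - 1) * (w * g * y (q * w)) by ring.
rewrite [leRHS]mulrA; apply: le_trans (ler_wpM2l wg yqw_le).
by rewrite ler_piMl// mulr_ge0.
Qed.

Theorem theorem2p3 (R : realType) (q alpha a : R) (n0 : int) (y : R -> R)
  (q_gt0 : 0 < q) (q_lt1 : q < 1)
  (alpha_gt0 : 0 < alpha) (alpha_le1 : alpha <= 1)
  (aE : a = q ^ n0)
  (y_ge0 : 0 <= y (q ^ n0))
  (y_incr : qincreasing q y) :
  forall (t : R) (n : int), t = q ^ n -> n < n0 ->
    0 <= qfrac_deriv q (a * q) alpha y t.
Proof.
move=> t n -> n_lt.
have q01 : 0 < q < 1 by rewrite q_gt0.
have qX_gt0 (m : int) : 0 < q ^ m by rewrite exprz_gt0.
have qXS (m : int) : q * q ^ m = q ^ (m + 1).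
  by rewrite expfzDr ?gt_eqF// expr1z mulrC.
have nablaq_ge0 f : f (q * q ^ n) <= f (q ^ n) -> 0 <= nablaq q f (q ^ n).
  by move=> le_f; rewrite divr_ge0 ?mulr_ge0 ?subr_ge0// ltW.
rewrite /qfrac_deriv; case: ifP => _; apply: nablaq_ge0.
  by rewrite qXS qincreasing_expz//; lia.
(* The absolute value turns the positive gap [n0 - n] into the natural number [K] of
   [le_qfrac_int]. *)
have n0E : n0 = n + `|n0 - n|%N%:Z by lia.
have -> : a * q = q ^ (n + `|n0 - n|.+1%:Z).
  by rewrite aE mulrC qXS; congr (q ^ _); lia.
by apply: le_qfrac_int => //; rewrite ?subr_ge0// -n0E.
Qed.
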